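(* Consider the following $N$-atom clock estimation problem. Let $Q$ be the $(N+1)$-dimensional Hilbert space with orthonormal basis $|0\rangle,\dots,|N\rangle$, let $J_z|k\rangle=(k-N/2)|k\rangle$, and for $\omega\in\mathbb{R}$ let $\Omega(\omega)=e^{-iJ_z\omega}$. A $t_f$-query algorithm $\mathcal{Q}$ consists of a finite-dimensional ancilla system $A$, an initial state $\rho(0)$ on $Q\otimes A$, unitaries $U(1),\dots,U(t_f)$ on $Q\otimes A$, a POVM $\{P_a\}_a$ on $Q\otimes A$ with finitely many outcomes, and a real frequency estimate $f_a$ assigned to each outcome $a$. Given $\omega$, the final state is $\rho_\omega(t_f)=\Omega(\omega)U(t_f)\cdots\Omega(\omega)U(1)\,\rho(0)\,U(1)^\dagger\Omega(\omega)^\dagger\cdots U(t_f)^\dagger\Omega(\omega)^\dagger$ (with $\Omega(\omega)$ acting on $Q$ only), and $q(a|\omega,\mathcal{Q})=\mathrm{tr}(P_a\rho_\omega(t_f))$. For a probability density $p$ on $\mathbb{R}$ (the prior) and a cost function $C:\mathbb{R}\to\mathbb{R}$, the expected cost of $\mathcal{Q}$ is $\sum_a\int C(\omega-f_a)\,q(a|\omega,\mathcal{Q})\,p(\omega)\,d\omega$, and for a set $F\subseteq\mathbb{R}$, $S_C(p,F)$ denotes the infimum of the expected cost over all $t_f$-query algorithms whose estimates $f_a$ all lie in $F$. Let $C$ be twice differentiable and non-negative with $C''(x)\leq b$ for all $x$, $C(0)=0$, and $C$ monotone on $[0,\infty)$ and on $(-\infty,0]$. Let $F=\{f_1,\dots,f_n\}$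 with $f_1<f_2<\dots<f_n$, and define $M(\omega)=C(\omega-f_1)$ for $\omega\leq f_1$, $M(\omega)=C(\omega-f_n)$ for $\omega\geq f_n$, and $M(\omega)=0$ otherwise. Then $$S_C(p,F)-S_C(p,\mathbb{R})\leq \max_j \frac{b}{8}(f_{j+1}-f_j)^2+\int M(\omega)p(\omega)\,d\omega.$$ *)

(* Defs.v *)
From HB Require Import structures.
From mathcomp Require Import all_boot all_order all_algebra.
From mathcomp Require Import all_classical all_reals all_analysis.
From mathcomp Require Import complex.
From mathcomp Require mxtens.

Set Implicit Arguments.
Unset Strict Implicit.
Unset Printing Implicit Defensive.

Import Order.TTheory GRing.Theory Num.Theory.
Local Open Scope ring_scope.
Local Open Scope classical_set_scope.

Section Clock.
Variable R : realType.
Local Notation C := (R[i]).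

Definition adjmx m n (A : 'M[C]_(m, n)) : 'M[C]_(n, m) := (map_mx conjc A)^T.

Definition unitary_mx n (U : 'M[C]_n) : Prop :=
  U *m adjmx U = 1%:M /\ adjmx U *m U = 1%:M.

Definition psd n (A : 'M[C]_n) : Prop :=
  adjmx A = A /\ forall v : 'cV[C]_n, 0 <= (adjmx v *m A *m v) 0 0.

Definition density_mx n (rho : 'M[C]_n) : Prop := psd rho /\ \tr rho = 1.

Definition expi (theta : R) : C := (cos theta +i* sin theta)%C.

(* J_z |k> = (k - N/2) |k>, Omega(w) = exp(-i J_z w) on Q = C^(N+1) *)
Definition Jz_eig (N : nat) (k : 'I_N.+1) : R := k%:R - N%:R / 2.
Definition Omega (N : nat) (w : R) : 'M[C]_N.+1 :=
  diag_mx (\row_k expi (- (Jz_eig k * w))).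

Record Alg (N tf : nat) := MkAlg {
  anc_dim : nat;
  anc_dim_pos : (0 < anc_dim)%N;
  rho0 : 'M[C]_(N.+1 * anc_dim);
  rho0_state : density_mx rho0;
  Uq : nat -> 'M[C]_(N.+1 * anc_dim);
  Uq_unitary : forall t, (1 <= t <= tf)%N -> unitary_mx (Uq t);
  nout : nat;
  povm : 'I_nout -> 'M[C]_(N.+1 * anc_dim);
  povm_psd : forall a, psd (povm a);
  povm_sum : \sum_(a < nout) povm a = 1%:M;
  est : 'I_nout -> R
}.
Arguments povm {N tf} a _ : rename.
Arguments est {N tf} a _ : rename.

Definition OmegaQA N tf (A : Alg N tf) (w : R) : 'M[C]_(N.+1 * anc_dim A) :=
  mxtens.tensmx (Omega N w) (1%:M : 'M[C]_(anc_dim A)).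

Fixpoint state N tf (A : Alg N tf) (w : R) (t : nat) : 'M[C]_(N.+1 * anc_dim A) :=
  match t with
  | 0 => rho0 A
  | t'.+1 => let W := OmegaQA A w *m Uq A t'.+1 in
             W *m state A w t' *m adjmx W
  end.

Definition outprob N tf (A : Alg N tf) (w : R) (a : 'I_(nout A)) : R :=
  complex.Re (\tr (povm A a *m state A w tf)).
Arguments outprob {N tf} A w a.

Definition exp_cost N tf (Cf : R -> R) (p : R -> R) (A : Alg N tf) : \bar R :=
  (\sum_(a < nout A)
     \int[@lebesgue_measure R]_(w in [set: R])
        (Cf (w - est A a) * outprob A w a * p w)%:E)%E.

Definition S_C (N tf : nat) (Cf : R -> R) (p : R -> R) (F : set R) : \bar R :=
  ereal_inf [set exp_cost Cf p A | A in [set A : Alg N tf | forall a, F (est A a)]].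

Definition prob_density (p : R -> R) : Prop :=
  measurable_fun [set: R] p /\ (forall x, 0 <= p x) /\
  (\int[@lebesgue_measure R]_(x in [set: R]) (p x)%:E = 1)%E.

(* the set F = {f_0, ..., f_{n-1}} (0-indexed) *)
Definition finset_of (n : nat) (f : nat -> R) : set R :=
  [set x | exists2 i, (i < n)%N & x = f i].

Definition Mfun (Cf : R -> R) (n : nat) (f : nat -> R) (w : R) : R :=
  if w <= f 0%N then Cf (w - f 0%N)
  else if f n.-1 <= w then Cf (w - f n.-1) else 0.

(* max_j (b/8) (f_{j+1} - f_j)^2 over consecutive pairs (0 if n = 1) *)
Definition gapterm (b : R) (n : nat) (f : nat -> R) : R :=
  \big[Num.max/0]_(0 <= j < n.-1) (b / 8 * (f j.+1 - f j) ^+ 2).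

End Clock.

(* Main.v *)
Require Import Defs.
From HB Require Import structures.
From mathcomp Require Import all_boot all_order all_algebra.
From mathcomp Require Import all_classical all_reals all_analysis.
From mathcomp Require Import measurable_realfun.
From mathcomp Require Import complex spectral ring lra.
From mathcomp Require mxtens.

Import Order.TTheory GRing.Theory Num.Theory.
Local Open Scope ring_scope.
Local Open Scope classical_set_scope.

(** Any algorithm can be turned into one with estimates in F by rounding each
    estimate x at random. If f_j <= x <= f_(j+1), answer f_j with probability l
    and f_(j+1) with probability 1 - l, where x = l f_j + (1 - l) f_(j+1); since
    C - (b/2) id^2 is concave, this costs at most (b/2) l (1 - l) gap^2
    <= (b/8) gap^2 more, whatever the frequency. If x is outside the range of F,
    answer the nearest endpoint: by monotonicity of C this costs at most M(w)
    more. The random choice is absorbed in the measurement by splitting each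
    POVM element P_a into l P_a and (1 - l) P_a, so it remains to integrate
    the pointwise bounds against the outcome probabilities, which sum to 1. *)

Set Implicit Arguments.
Unset Strict Implicit.
Unset Printing Implicit Defensive.

(** * States and outcome probabilities *)

Section Quantum.
Variable R : realType.
Local Notation C := (R[i]).

Lemma adjmxM m n q (A : 'M[C]_(m, n)) (B : 'M[C]_(n, q)) :
  adjmx (A *m B) = adjmx B *m adjmx A.
Proof. by rewrite /adjmx map_mxM trmx_mul. Qed.

Lemma adjmxK m n (A : 'M[C]_(m, n)) : adjmx (adjmx A) = A.
Proof. by apply/matrixP => i j; rewrite !mxE conjcK. Qed.

Lemma adjmxE m n (A : 'M[C]_(m, n)) : adjmx A = map_mx Num.conj A^T.
Proof. by apply/matrixP => i j; rewrite !mxE. Qed.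

Lemma psd_conj m n (B : 'M[C]_(m, n)) (A : 'M[C]_n) :
  psd A -> psd (B *m A *m adjmx B).
Proof.
move=> [Ah A0]; split=> [|v]; first by rewrite !adjmxM adjmxK Ah mulmxA.
have := A0 (adjmx B *m v).
by rewrite adjmxM adjmxK !mulmxA.
Qed.

Lemma psd_diag_ge0 n (A : 'M[C]_n) i : psd A -> 0 <= A i i.
Proof.
move=> [_ /(_ (delta_mx i 0))].
have -> : adjmx (delta_mx i 0 : 'cV[C]_n) = delta_mx 0 i.
  by apply/matrixP => k l; rewrite !mxE andbC; case: (_ && _); rewrite ?conjc1 ?conjc0.
by rewrite -rowE -colE !mxE.
Qed.

(** Diagonalise [A] by the unitary [P] of the spectral theorem. By cyclicity the trace is the sum of
    the eigenvalues of [A] times the diagonal entries of [B] conjugated by [P], and both factors are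
    diagonal entries of positive semidefinite matrices. *)
Lemma psd_trace_mul_ge0 n (A B : 'M[C]_n) : psd A -> psd B -> 0 <= \tr (A *m B).
Proof.
move=> hA hB; pose P := spectralmx A.
have Pu : P \is unitarymx by exact: spectral_unitarymx.
have Pinv : invmx P = adjmx P by rewrite invmx_unitary// adjmxE.
have /orthomx_spectralP Aeq : A \is normalmx.
  by apply/normalmxP; rewrite -adjmxE hA.1.
rewrite -/P in Aeq.
have Deq : P *m A *m adjmx P = diag_mx (spectral_diag A).
  by rewrite {1}Aeq -Pinv !mulmxA mulmxV ?unitarymx_unit// mul1mx mulmxK ?unitarymx_unit.
rewrite {1}Aeq Pinv -2!mulmxA mxtrace_mulC -!mulmxA mul_diag_mx.
apply: sumr_ge0 => i _; rewrite mxE mulr_ge0//.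
  by have := psd_diag_ge0 i (psd_conj P hA); rewrite Deq mxE eqxx mulr1n.
by rewrite mulmxA; apply/psd_diag_ge0/psd_conj.
Qed.

Lemma expiM_conj (t : R) : expi t * conjc (expi t) = 1.
Proof. by rewrite /expi; simpc; rewrite -!expr2 cos2Dsin2; congr (_ +i* _)%C; ring. Qed.

Lemma OmegaQA_unitary N tf (A : Alg R N tf) w : unitary_mx (OmegaQA A w).
Proof.
suff h : OmegaQA A w *m adjmx (OmegaQA A w) = 1%:M.
  by split => //; exact: mulmx1C.
have -> : adjmx (OmegaQA A w) = mxtens.tensmx (adjmx (Omega N w)) 1%:M.
  by rewrite /adjmx mxtens.map_mxT map_mx1 mxtens.trmx_tens trmx1.
rewrite mxtens.tensmx_mul mulmx1.
have -> : Omega N w *m adjmx (Omega N w) = 1%:M.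
  apply/matrixP => i j; rewrite /Omega /adjmx map_diag_mx tr_diag_mx mulmx_diag !mxE.
  by case: eqP => // ->; rewrite expiM_conj.
(* The Kronecker product of two identities is the identity: two paired indices agree exactly when
   both components do. *)
apply/matrixP => i j; rewrite !mxE -natrM mulnb -xpair_eqE.
by rewrite -!surjective_pairing (can_eq (@mxtens.mxtens_unindexK _ _)).
Qed.

(** Each query conjugates the state by a unitary, which preserves positivity and trace. The bound on
    [t] is there because [Uq] is unitary only at the times 1 to [tf]. *)
Lemma state_density N tf (A : Alg R N tf) w t : (t <= tf)%N ->
  density_mx (state A w t).
Proof.
elim: t => [_|t IH tle]; first exact: rho0_state.
have [IH1 IH2] := IH (ltnW tle).
rewrite /=; set W := OmegaQA A w *m Uq A t.+1.
have [_ Wu] : unitary_mx W.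
  have [a1 a2] := OmegaQA_unitary A w.
  have [b1 b2] : unitary_mx (Uq A t.+1) by exact: Uq_unitary.
  split; rewrite /W adjmxM -mulmxA.
    by rewrite (mulmxA (Uq A t.+1)) b1 mul1mx.
  by rewrite (mulmxA (adjmx (OmegaQA A w))) a2 mul1mx.
split; first exact: psd_conj.
by rewrite -mulmxA mxtrace_mulC -mulmxA Wu mulmx1.
Qed.

Lemma outprob_ge0 N tf (A : Alg R N tf) w (a : 'I_(nout A)) : 0 <= outprob w a.
Proof.
have := psd_trace_mul_ge0 (povm_psd a) (state_density A w (leqnn tf)).1.
(* In the order on complex numbers, being nonnegative means having zero imaginary part and
   nonnegative real part. *)
by rewrite lecE => /andP[].
Qed.

Lemma outprob_sum N tf (A : Alg R N tf) w : \sum_(a < nout A) outprob w a = 1.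
Proof.
rewrite /outprob -raddf_sum -raddf_sum -mulmx_suml povm_sum mul1mx /=.
by have -> := (state_density A w (leqnn tf)).2.
Qed.
End Quantum.

(** * Rounding a single estimate *)

Section Cost.
Import numFieldNormedType.Exports.
Variable R : realType.
Implicit Types (Cf : R -> R) (b : R).

(** This is Jensen's inequality for the concave function [E], which is [Cf] minus [b / 2] times the
    square; the square itself has Jensen defect exactly [l * (1 - l) * (y - x) ^+ 2]. Concavity is
    used through the mean value theorem on both sides of the intermediate point [z], with [D] the
    nonincreasing derivative of [E]. *)
Lemma convex_defect_le Cf b :
  (forall x, derivable Cf x 1) -> (forall x, derivable Cf^`() x 1) ->
  (forall x, Cf^`()^`() x <= b) ->
  forall (l x y : R), 0 <= l <= 1 -> x <= y ->
  l * Cf x + (1 - l) * Cf y <=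
    Cf (l * x + (1 - l) * y) + b / 2 * (l * (1 - l)) * (y - x) ^+ 2.
Proof.
move=> d1 d2 hb l x y /andP[l0 l1] xy.
pose D z := derive1 Cf z - b * z.
pose E z := Cf z - b / 2 * z ^+ 2.
have dE (z : R) : is_derive z 1 E (D z).
  have h1 : is_derive z 1 Cf (derive1 Cf z) by rewrite derive1E; exact: derivableP.
  rewrite /E /D; apply: is_derive_eq.
  by rewrite /GRing.scale /=; field.
have dD (z : R) : is_derive z 1 D (derive1 (derive1 Cf) z - b).
  have h1 : is_derive z 1 (derive1 Cf) (derive1 (derive1 Cf) z).
    by rewrite [X in is_derive _ _ _ X]derive1E; exact: derivableP.
  rewrite /D; apply: is_derive_eq.
  by rewrite /GRing.scale /=; ring.
have cE (u v : R) : {within `[u, v], continuous E}.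
  by apply: derivable_within_continuous => z _; exact: (@ex_derive _ _ _ _ _ _ _ (dE z)).
have cD (u v : R) : {within `[u, v], continuous D}.
  by apply: derivable_within_continuous => z _; exact: (@ex_derive _ _ _ _ _ _ _ (dD z)).
have Dle u v : u <= v -> D v <= D u.
  move=> uv; have [c _ ce] := MVT_segment uv (fun z _ => dD z) (cD u v).
  have := hb c; rewrite -subr_le0 -[D v <= _]subr_le0 ce => h.
  by rewrite mulr_le0_ge0 ?subr_ge0.
pose z := l * x + (1 - l) * y.
have xz : x <= z by rewrite /z; nra.
have zy : z <= y by rewrite /z; nra.
have [c1 c1i e1] := MVT_segment xz (fun z _ => dE z) (cE x z).
have [c2 c2i e2] := MVT_segment zy (fun z _ => dE z) (cE z y).
have c12 : D c2 <= D c1.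
  apply: Dle; move: c1i c2i; rewrite !in_itv /= => /andP[_ h1] /andP[h2 _].
  exact: le_trans h1 h2.
(* Since [z - x = (1 - l) * (y - x)] and [y - z = l * (y - x)], weighting the two increments of [E]
   by [l] and [1 - l] gives both slopes this same factor. *)
have k0 : 0 <= l * (1 - l) * (y - x) by rewrite !mulr_ge0// subr_ge0.
have hk : l * (1 - l) * (y - x) * D c2 <= l * (1 - l) * (y - x) * D c1.
  exact: ler_wpM2l.
rewrite -/z.
have f1 : l * (E z - E x) = l * (1 - l) * (y - x) * D c1 by rewrite e1 /z; ring.
have f2 : (1 - l) * (E y - E z) = l * (1 - l) * (y - x) * D c2 by rewrite e2 /z; ring.
have f3 : (1 - l) * (E y - E z) - l * (E z - E x) <= 0 by rewrite f1 f2 subr_le0.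
rewrite -subr_le0; apply: le_trans f3; rewrite le_eqVlt; apply/orP; left; apply/eqP.
by rewrite /E; move: (Cf z) => Cz; rewrite /z; field.
Qed.

(** Induction on the last index: either [x] lies beyond [f n], hence in the last gap, or the earlier
    points suffice. The alternative [x = f n] covers [n = 0], where there is no gap. *)
Lemma gap_locate (f : nat -> R) n x : f 0%N <= x -> x <= f n ->
  x = f n \/ exists2 j, (j < n)%N & f j <= x <= f j.+1.
Proof.
move=> f0x; elim: n => [xf0|n IH xfn]; first by left; apply/le_anti/andP.
have [xn|nx] := leP x (f n).
  case: (IH xn) => [e|[j jn h]]; right.
    by exists n => //; rewrite xfn e lexx.
  by exists j => //; exact: leqW.
by right; exists n => //; rewrite xfn ltW.
Qed.

(** The maximum starts from the default value 0, so this holds whatever the sign of [b]. *)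
Lemma gapterm_ge0 b n f : 0 <= gapterm b n f.
Proof.
rewrite /gapterm; elim: (index_iota _ _) => [|j s IH]; first by rewrite big_nil.
by rewrite big_cons le_max IH orbT.
Qed.

Lemma gapterm_ge b n f j : (j < n.-1)%N ->
  b / 8 * (f j.+1 - f j) ^+ 2 <= gapterm b n f.
Proof.
rewrite -[(j < _)%N]/((0 <= j < _)%N) -mem_index_iota /gapterm.
elim: (index_iota _ _) => // k s IH; rewrite in_cons big_cons le_max.
by case/orP => [/eqP ->|/IH ->]; rewrite ?lexx ?orbT.
Qed.

Section Rounding.
Variables (Cf : R -> R) (b : R) (n : nat) (f : nat -> R).
Hypothesis d1 : forall x, derivable Cf x 1.
Hypothesis d2 : forall x, derivable Cf^`() x 1.
Hypothesis hb : forall x, Cf^`()^`() x <= b.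
Hypothesis C0 : forall x, 0 <= Cf x.
Hypothesis incr : forall x y, 0 <= x -> x <= y -> Cf x <= Cf y.
Hypothesis decr : forall x y, x <= y -> y <= 0 -> Cf y <= Cf x.
Hypothesis n0 : (0 < n)%N.
Hypothesis fincr : forall i, (i.+1 < n)%N -> f i < f i.+1.

Lemma Mfun_ge0 w : 0 <= Mfun Cf n f w.
Proof. by rewrite /Mfun; do 2 case: ifP => //. Qed.

(** The estimate [x] is replaced by [y] with probability [l] and by [z] otherwise. The bound is
    uniform in [w], so it can later be averaged against any outcome probabilities. *)
Definition rounds_to (x l y z : R) : Prop :=
  forall w, l * Cf (w - y) + (1 - l) * Cf (w - z) <=
    Cf (w - x) + (gapterm b n f + Mfun Cf n f w).

Lemma exists_rounding x : exists l y z,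
  [/\ 0 <= l <= 1, finset_of n f y, finset_of n f z & rounds_to x l y z].
Proof.
have G0 := gapterm_ge0 b n f.
(* Deterministic rounding is the degenerate coin with [l = 1]. *)
have single i : (i < n)%N -> rounds_to x 1 (f i) (f i) -> exists l y z,
    [/\ 0 <= l <= 1, finset_of n f y, finset_of n f z & rounds_to x l y z].
  by move=> ilt h; exists 1, (f i), (f i); split; rewrite ?ler01 ?lexx//; exists i.
have [x0|x0] := leP x (f 0%N).
  apply: (single 0%N) => // w; rewrite subrr mul0r addr0 mul1r.
  have := Mfun_ge0 w; rewrite /Mfun.
  (* For [w <= f 0] the whole cost of answering [f 0] is [Mfun]; for larger [w], moving the estimate
     from [x] up to [f 0] brings it closer to [w] on the same side. *)
  case: ifP => [wf _|/negbT]; first by have := C0 (w - x); lra.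
  rewrite -ltNge => fw M0.
  suff : Cf (w - f 0%N) <= Cf (w - x) by move=> ?; apply: ler_wpDr => //; lra.
  by apply: incr; lra.
have f0n : f 0%N <= f n.-1.
  move: (fincr); rewrite -{1}(prednK n0); elim: n.-1 => // m IH h.
  apply: le_trans (IH _) (ltW (h m _)) => // i im; apply: h; exact: ltnW.
have [xn|xn] := leP (f n.-1) x.
  apply: (single n.-1) => [|w]; first by rewrite prednK.
  rewrite subrr mul0r addr0 mul1r.
  have M0 := Mfun_ge0 w; have [wf|fw] := leP w (f n.-1).
    suff : Cf (w - f n.-1) <= Cf (w - x) by lra.
    by apply: decr; lra.
  (* [Mfun] tests [w <= f 0] first, so that branch must be excluded before it reduces to the cost at
     the right endpoint. *)
  have f0w : (w <= f 0%N) = false.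
    apply/negbTE; rewrite -ltNge; apply: le_lt_trans fw; exact: f0n.
  have := C0 (w - x); rewrite /Mfun f0w (ltW fw); lra.
have [e|[j jn /andP[xj xj1]]] := gap_locate (ltW x0) (ltW xn).
  by rewrite e ltxx in xn.
have fj : f j < f j.+1.
  by apply: fincr; rewrite -(prednK n0) ltnS.
pose g := f j.+1 - f j; have g0 : 0 < g by rewrite subr_gt0.
(* The solution of [x = l * f j + (1 - l) * f j.+1], so that rounding is unbiased. *)
pose l := (f j.+1 - x) / g.
have l0 : 0 <= l by rewrite divr_ge0 ?subr_ge0// ltW.
have l1 : l <= 1 by rewrite ler_pdivrMr// mul1r /g; lra.
exists l, (f j), (f j.+1); split.
- by rewrite l0.
- by exists j => //; apply: leq_trans jn _; exact: leq_pred.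
- by exists j.+1 => //; rewrite -(prednK n0) ltnS.
move=> w.
(* Passing to [w - f j] reverses the order of the endpoints, so the weights are exchanged. *)
have l01 : 0 <= 1 - l <= 1 by apply/andP; split; lra.
have := convex_defect_le d1 d2 hb l01 (_ : w - f j.+1 <= w - f j).
have -> : (1 - l) * (w - f j.+1) + (1 - (1 - l)) * (w - f j) = w - x.
  by rewrite /l /g; field; rewrite -/g; lra.
have -> : w - f j - (w - f j.+1) = g by rewrite /g; ring.
have -> : 1 - (1 - l) = l by ring.
move=> /(_ ltac:(lra)) h.
have M0 := Mfun_ge0 w.
suff h2 : b / 2 * ((1 - l) * l) * g ^+ 2 <= gapterm b n f by lra.
(* For [b >= 0], use [l * (1 - l) <= 1 / 4], in the form of a nonnegative square. For [b < 0] the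
   defect is nonpositive and the default 0 in [gapterm] suffices. *)
have [b0|b0] := leP 0 b.
  apply: le_trans (gapterm_ge b f jn); rewrite -/g ler_wpM2r ?sqr_ge0//.
  have : 0 <= b * (l - 1 / 2) ^+ 2 by rewrite mulr_ge0// sqr_ge0.
  lra.
apply: le_trans G0; rewrite mulr_le0_ge0 ?sqr_ge0// mulr_le0_ge0//; first by lra.
by rewrite mulr_ge0// subr_ge0.
Qed.
End Rounding.
End Cost.

(** * Measurability of the outcome probabilities *)

Section Meas.
Variable R : realType.
Local Notation C := (R[i]).

(** Both parts are tracked because the real part of a product involves the imaginary parts of its
    factors. *)
Definition measurable_cplx (g : R -> C) : Prop :=
  measurable_fun [set: R] (fun w => complex.Re (g w)) /\
  measurable_fun [set: R] (fun w => complex.Im (g w)).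

Lemma measurable_cplx_cst c : measurable_cplx (fun=> c).
Proof. by split; exact: measurable_cst. Qed.

Lemma measurable_cplxD g h : measurable_cplx g -> measurable_cplx h ->
  measurable_cplx (fun w => g w + h w).
Proof.
move=> [g1 g2] [h1 h2]; split.
  by under eq_fun do rewrite raddfD; exact: measurable_funD.
by under eq_fun do rewrite raddfD; exact: measurable_funD.
Qed.

Lemma measurable_cplxM g h : measurable_cplx g -> measurable_cplx h ->
  measurable_cplx (fun w => g w * h w).
Proof.
move=> [g1 g2] [h1 h2]; split.
  rewrite [X in measurable_fun _ X](_ : _ = (fun w =>
    complex.Re (g w) * complex.Re (h w) - complex.Im (g w) * complex.Im (h w))).
    by apply: measurable_funB; exact: measurable_funM.
  by apply/funext => w; case: (g w) => ? ?; case: (h w).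
rewrite [X in measurable_fun _ X](_ : _ = (fun w =>
    complex.Re (g w) * complex.Im (h w) + complex.Im (g w) * complex.Re (h w))).
  by apply: measurable_funD; exact: measurable_funM.
by apply/funext => w; case: (g w) => ? ?; case: (h w).
Qed.

Lemma measurable_cplx_conj g : measurable_cplx g ->
  measurable_cplx (fun w => conjc (g w)).
Proof.
move=> [g1 g2]; split.
  rewrite [X in measurable_fun _ X](_ : _ = (fun w => complex.Re (g w)))//.
  by apply/funext => w; case: (g w).
rewrite [X in measurable_fun _ X](_ : _ = (fun w => - complex.Im (g w))).
  exact: measurable_funN.
by apply/funext => w; case: (g w).
Qed.

Lemma measurable_cplx_sum (I : Type) (s : seq I) (g : I -> R -> C) :
  (forall i, measurable_cplx (g i)) ->
  measurable_cplx (fun w => \sum_(i <- s) g i w).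
Proof.
move=> mg; elim: s => [|i s IH].
  by under eq_fun do rewrite big_nil; exact: measurable_cplx_cst.
by under eq_fun do rewrite big_cons; exact: measurable_cplxD.
Qed.

Lemma measurable_cplx_expi (k : R) : measurable_cplx (fun w => expi (- (k * w))).
Proof.
have mk : measurable_fun [set: R] (fun w : R => - (k * w)).
  by apply: measurable_funN; apply: measurable_funM.
split; apply: measurableT_comp mk; apply: continuous_measurable_fun.
  exact: continuous_cos.
exact: continuous_sin.
Qed.

Definition measurable_mx m n (X : R -> 'M[C]_(m, n)) : Prop :=
  forall i j, measurable_cplx (fun w => X w i j).

Lemma measurable_mx_mul m n q (X : R -> 'M[C]_(m, n)) (Y : R -> 'M[C]_(n, q)) :
  measurable_mx X -> measurable_mx Y -> measurable_mx (fun w => X w *m Y w).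
Proof.
move=> mX mY i j; under eq_fun do rewrite mxE.
by apply: measurable_cplx_sum => k; exact: measurable_cplxM.
Qed.

Lemma measurable_mx_adj m n (X : R -> 'M[C]_(m, n)) :
  measurable_mx X -> measurable_mx (fun w => adjmx (X w)).
Proof.
by move=> mX i j; under eq_fun do rewrite !mxE; exact: measurable_cplx_conj.
Qed.

Lemma measurable_mx_cst m n (X : 'M[C]_(m, n)) : measurable_mx (fun=> X).
Proof. by move=> i j; exact: measurable_cplx_cst. Qed.

Lemma measurable_mx_OmegaQA N tf (A : Alg R N tf) : measurable_mx (OmegaQA A).
Proof.
(* Each entry is a phase times two Kronecker deltas, which are constant in [w]. *)
move=> i j; under eq_fun do rewrite !mxE -mulr_natr.
apply: measurable_cplxM; last exact: measurable_cplx_cst.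
apply: measurable_cplxM; last exact: measurable_cplx_cst.
exact: measurable_cplx_expi.
Qed.

Lemma measurable_mx_state N tf (A : Alg R N tf) t : measurable_mx (state A ^~ t).
Proof.
elim: t => [|t IH] /=; first exact: measurable_mx_cst.
have mW : measurable_mx (fun w => OmegaQA A w *m Uq A t.+1).
  by apply: measurable_mx_mul (measurable_mx_cst _); exact: measurable_mx_OmegaQA.
by apply: measurable_mx_mul (measurable_mx_adj mW); exact: measurable_mx_mul.
Qed.

Lemma measurable_outprob N tf (A : Alg R N tf) (a : 'I_(nout A)) :
  measurable_fun [set: R] (fun w => outprob w a).
Proof.
suff [] : measurable_cplx (fun w => \tr (povm a *m state A w tf)) by [].
apply: measurable_cplx_sum => i.
exact: (measurable_mx_mul (measurable_mx_cst _) (@measurable_mx_state _ _ A tf)).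
Qed.
End Meas.

(** * Randomized rounding of an algorithm *)

Section Rand.
Variable R : realType.
Local Notation C := (R[i]).

Lemma psd_scale n (c : R) (A : 'M[C]_n) : 0 <= c -> psd A -> psd (c%:C%C *: A).
Proof.
move=> c0 [Ah A0]; split=> [|v].
  rewrite -[in RHS]Ah; apply/matrixP => i j; rewrite !mxE rmorphM /=.
  by congr (_ * _); apply/eqP; rewrite eq_complex /= oppr0 !eqxx.
by rewrite -scalemxAr -scalemxAl mxE mulr_ge0// lecE /= eqxx c0.
Qed.

Variables (N tf : nat) (A : Alg R N tf).

Section Def.
Variables (l y z : 'I_(nout A) -> R).
Hypothesis l01 : forall a, 0 <= l a <= 1.

(** The coin toss after outcome [a] is encoded by doubling the outcome set: the left copy of [a]
    stands for the answer [y a], the right copy for [z a]. The bias may depend on [a]. *)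
Definition rand_povm (i : 'I_(nout A + nout A)) : 'M[C]_(N.+1 * anc_dim A) :=
  match fintype.split i with
  | inl a => ((l a)%:C)%C *: povm a
  | inr a => ((1 - l a)%:C)%C *: povm a
  end.

Definition rand_est (i : 'I_(nout A + nout A)) : R :=
  match fintype.split i with inl a => y a | inr a => z a end.

Lemma rand_est_lshift a : rand_est (lshift _ a) = y a.
Proof. by rewrite /rand_est -[lshift _ a]/(unsplit (inl a)) unsplitK. Qed.

Lemma rand_est_rshift a : rand_est (rshift _ a) = z a.
Proof. by rewrite /rand_est -[rshift _ a]/(unsplit (inr a)) unsplitK. Qed.

Lemma rand_povm_psd i : psd (rand_povm i).
Proof.
rewrite /rand_povm; case: fintype.split => a; apply: psd_scale (povm_psd a);
  have /andP[] := l01 a => //.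
by rewrite subr_ge0.
Qed.

Lemma rand_povm_lshift a : rand_povm (lshift _ a) = ((l a)%:C)%C *: povm a.
Proof. by rewrite /rand_povm -[lshift _ a]/(unsplit (inl a)) unsplitK. Qed.

Lemma rand_povm_rshift a : rand_povm (rshift _ a) = ((1 - l a)%:C)%C *: povm a.
Proof. by rewrite /rand_povm -[rshift _ a]/(unsplit (inr a)) unsplitK. Qed.

Lemma rand_povm_sum : \sum_i rand_povm i = 1%:M.
Proof.
rewrite big_split_ord /= -big_split /= -(povm_sum A); apply: eq_bigr => a _.
rewrite rand_povm_lshift rand_povm_rshift -scalerDl -rmorphD /=.
by rewrite addrC subrK scale1r.
Qed.

(** Only the measurement and the estimates change, so the final state is that of [A]. *)
Definition randomize : Alg R N tf :=
  MkAlg (anc_dim_pos A) (rho0_state A) (@Uq_unitary _ _ _ A)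
    rand_povm_psd rand_povm_sum rand_est.

Lemma state_randomize w t : state randomize w t = state A w t.
Proof. by elim: t => //= t ->. Qed.

Lemma outprob_randomizel w a :
  outprob w (lshift _ a : 'I_(nout randomize)) = l a * outprob w a.
Proof.
rewrite /outprob /= rand_povm_lshift state_randomize -scalemxAl linearZ /=.
by case: (\tr _) => u v /=; rewrite mul0r subr0.
Qed.

Lemma outprob_randomizer w a :
  outprob w (rshift _ a : 'I_(nout randomize)) = (1 - l a) * outprob w a.
Proof.
rewrite /outprob /= rand_povm_rshift state_randomize -scalemxAl linearZ /=.
by case: (\tr _) => u v /=; rewrite mul0r subr0.
Qed.

End Def.
End Rand.

(** * Integration of the pointwise bounds *)

Section Integral.
Variables (R : realType) (N tf : nat) (Cf p : R -> R).
Hypothesis mC : measurable_fun [set: R] Cf.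
Hypothesis C0 : forall x, 0 <= Cf x.
Hypothesis mp : measurable_fun [set: R] p.
Hypothesis p0 : forall x, 0 <= p x.

Lemma measurable_cost_outcome (A : Alg R N tf) (a : 'I_(nout A)) :
  measurable_fun [set: R] (fun w => Cf (w - est a) * outprob w a * p w).
Proof.
apply: measurable_funM mp; apply: measurable_funM (measurable_outprob a).
by apply: measurableT_comp mC _; apply: measurable_funB.
Qed.

(** Nonnegativity allows the sum and the integral to be exchanged, so that costs can be compared by
    one pointwise inequality under a single integral. *)
Lemma exp_cost_integral (A : Alg R N tf) :
  exp_cost Cf p A = (\int[@lebesgue_measure R]_(w in [set: R])
    (\sum_(a < nout A) Cf (w - est a) * outprob w a * p w)%:E)%E.
Proof.
rewrite /exp_cost -ge0_integral_sum//.
- by apply: eq_integral => w _; rewrite sumEFin.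
- by move=> a; apply/measurable_EFinP; exact: measurable_cost_outcome.
- by move=> a w _; rewrite lee_fin !mulr_ge0// outprob_ge0.
Qed.

Lemma exp_cost_ge0 (A : Alg R N tf) : (0 <= exp_cost Cf p A)%E.
Proof.
rewrite exp_cost_integral; apply: integral_ge0 => w _.
by rewrite lee_fin sumr_ge0// => a _; rewrite !mulr_ge0// outprob_ge0.
Qed.

Lemma exp_cost_randomize (A : Alg R N tf) (l y z : 'I_(nout A) -> R)
    (l01 : forall a, 0 <= l a <= 1) (G : R) (M : R -> R) :
  0 <= G -> (forall w, 0 <= M w) -> measurable_fun [set: R] M ->
  (\int[@lebesgue_measure R]_(x in [set: R]) (p x)%:E = 1)%E ->
  (forall a w, l a * Cf (w - y a) + (1 - l a) * Cf (w - z a) <=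
     Cf (w - est a) + (G + M w)) ->
  (exp_cost Cf p (randomize y z l01) <= exp_cost Cf p A +
    (G%:E + \int[@lebesgue_measure R]_(w in [set: R]) (M w * p w)%:E))%E.
Proof.
move=> G0 M0 mM p1 h.
have mGp : measurable_fun [set: R] (fun w => (G%:E * (p w)%:E)%E).
  by apply: measurable_funeM; exact/measurable_EFinP.
have mMp : measurable_fun [set: R] (fun w => (M w * p w)%:E).
  by apply/measurable_EFinP; exact: measurable_funM.
have mS (B : Alg R N tf) : measurable_fun [set: R] (fun w =>
    (\sum_(a < nout B) Cf (w - est a) * outprob w a * p w)%:E).
  by apply/measurable_EFinP; apply: measurable_sum => a; exact: measurable_cost_outcome.
have S0 (B : Alg R N tf) w :
    (0 <= (\sum_(a < nout B) Cf (w - est a) * outprob w a * p w)%:E)%E.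
  by rewrite lee_fin sumr_ge0// => a _; rewrite !mulr_ge0// outprob_ge0.
(* The constant is written as an integral against [p], which has total mass 1. *)
have -> : (G%:E = \int[@lebesgue_measure R]_(w in [set: R]) (G%:E * (p w)%:E))%E.
  rewrite ge0_integralZl ?p1 ?mule1//; first exact/measurable_EFinP.
  by move=> w _; rewrite lee_fin.
rewrite -ge0_integralD//; last 2 first.
- by move=> w _; rewrite -EFinM lee_fin mulr_ge0.
- by move=> w _; rewrite lee_fin mulr_ge0.
rewrite !exp_cost_integral -ge0_integralD//; last 3 first.
- exact: mS.
- by move=> w _; rewrite -EFinM -EFinD lee_fin addr_ge0// mulr_ge0.
- exact: emeasurable_funD.
apply: ge0_le_integral => //.
- exact: mS.
- exact: emeasurable_funD (mS A) (emeasurable_funD mGp mMp).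
move=> w _; rewrite -EFinM -!EFinD lee_fin -mulrDl.
rewrite big_split_ord /= -big_split /=.
under eq_bigr do rewrite -mulrDl.
rewrite -!mulr_suml -mulrDl ler_wpM2r//.
(* The outcome probabilities sum to 1, so [G + M w] can be distributed over the outcomes and the
   bound checked for each [a]. *)
rewrite -[G + M w]mulr1 -(outprob_sum A w) mulr_sumr -big_split /=.
apply: ler_sum => a _.
rewrite outprob_randomizel outprob_randomizer rand_est_lshift rand_est_rshift.
rewrite !mulrA -!mulrDl ler_wpM2r ?outprob_ge0//.
by rewrite mulrC [Cf (w - z a) * _]mulrC.
Qed.
End Integral.

(** * Measurability of the boundary term and comparison of the optimal costs *)

Lemma measurable_Mfun (R : realType) (Cf : R -> R) n f :
  measurable_fun [set: R] Cf -> measurable_fun [set: R] (Mfun Cf n f).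
Proof.
move=> mC.
have mCs (c : R) : measurable_fun [set: R] (fun w => Cf (w - c)).
  by apply: measurableT_comp mC _; apply: measurable_funB.
by apply: measurable_fun_ifT => //; [|apply: measurable_fun_ifT => //];
  exact: measurable_fun_ler.
Qed.

(** The difference of optimal costs is stated as a sum on the right, which stays meaningful when the
    values in [\bar R] are infinite. *)
Theorem theorem3 (R : realType) (N tf : nat) (Cf : R -> R) (b : R)
  (p : R -> R) (n : nat) (f : nat -> R) :
  (forall x, derivable Cf x 1) ->
  (forall x, derivable Cf^`() x 1) ->
  (forall x, Cf^`()^`() x <= b) ->
  (forall x, 0 <= Cf x) ->
  Cf 0 = 0 ->
  ((forall x y, 0 <= x -> x <= y -> Cf x <= Cf y) \/
   (forall x y, 0 <= x -> x <= y -> Cf y <= Cf x)) ->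
  ((forall x y, x <= y -> y <= 0 -> Cf x <= Cf y) \/
   (forall x y, x <= y -> y <= 0 -> Cf y <= Cf x)) ->
  prob_density p ->
  (0 < n)%N ->
  (forall i, (i.+1 < n)%N -> f i < f i.+1) ->
  (S_C N tf Cf p (finset_of n f) <=
   S_C N tf Cf p [set: R] +
   ((gapterm b n f)%:E +
    \int[@lebesgue_measure R]_(w in [set: R]) (Mfun Cf n f w * p w)%:E))%E.
Proof.
move=> d1 d2 hb C0 C00 mono_pos mono_neg [mp [p0 p1]] n0 fincr.
(* If [Cf] is nonincreasing on this half-line, then [Cf 0 = 0] and nonnegativity force it to vanish
   there, so it is nondecreasing as well; [decr] is symmetric. *)
have incr x y : 0 <= x -> x <= y -> Cf x <= Cf y.
  case: mono_pos => [inc|dec] x0 xy; first exact: inc.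
  by apply: le_trans (C0 y); rewrite -C00; apply: dec.
have decr x y : x <= y -> y <= 0 -> Cf y <= Cf x.
  case: mono_neg => [inc|dec] xy y0; last exact: dec.
  by apply: le_trans (C0 x); rewrite -C00; apply: inc.
have mC : measurable_fun [set: R] Cf.
  apply: continuous_measurable_fun => x.
  exact/differentiable_continuous/derivable1_diffP.
have mM := @measurable_Mfun R Cf n f mC.
have M0 := @Mfun_ge0 R Cf n f C0.
set K := (_ + \int[_]_(w in _) _)%E.
have K0 : (0 <= K)%E.
  apply: adde_ge0; first by rewrite lee_fin gapterm_ge0.
  by apply: integral_ge0 => w _; rewrite lee_fin mulr_ge0.
have key (A : Alg R N tf) : (S_C N tf Cf p (finset_of n f) <= exp_cost Cf p A + K)%E.
  (* One triple of weight and two answers is chosen for each outcome of [A]. *)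
  have /choice[r hr] : forall a : 'I_(nout A), exists r : R * R * R,
      [/\ 0 <= r.1.1 <= 1, finset_of n f r.1.2, finset_of n f r.2 & forall w,
      r.1.1 * Cf (w - r.1.2) + (1 - r.1.1) * Cf (w - r.2) <=
      Cf (w - est a) + (gapterm b n f + Mfun Cf n f w)].
    move=> a.
    have [l [y [z h]]] := exists_rounding d1 d2 hb C0 incr decr n0 fincr (est a).
    by exists (l, y, z).
  have l01 a : 0 <= (r a).1.1 <= 1 by have [] := hr a.
  apply: le_trans (exp_cost_randomize mC C0 mp p0 (l := fun a => (r a).1.1)
    (y := fun a => (r a).1.2) (z := fun a => (r a).2) l01 (gapterm_ge0 b n f)
    M0 mM p1 _); last by move=> a; have [] := hr a.
  apply: ereal_inf_lbound; exists (randomize (fun a => (r a).1.2)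
    (fun a => (r a).2) l01) => //= i.
  by rewrite /rand_est; case: fintype.split => a; have [] := hr a.
have S0 : (0 <= S_C N tf Cf p [set: R])%E.
  by apply: le_ereal_inf_tmp => _ [A _ <-]; exact: exp_cost_ge0.
(* A finite [K] can be moved to the left before taking the infimum over [A]. Otherwise [K] is
   infinite, and so is the right-hand side, since [S0] excludes the value [-oo] for the other
   summand. *)
have [Kfin|] := boolP (K \is a fin_num).
  rewrite -leeBlDr//; apply: le_ereal_inf_tmp => _ [A _ <-].
  by rewrite leeBlDr.
rewrite ge0_fin_numE// -leNgt leye_eq => /eqP ->.
by rewrite addey ?leey// -ltNye (lt_le_trans _ S0).
Qed.
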